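(* Let $\mathcal{C}$ be a unital filtered $A_\infty$-category over $\Lambda$ and let $L=\oplus_{i=1}^rL_i$, $G=\oplus_{i=1}^rG_i$ be objects of $\mathcal{C}$ such that - $\hom_{\mathcal C}(G,L)\cong\Bbbk_\Lambda$ as $\hom_{\mathcal C}(G,G)$-modules; - $\hom^{>0}_{\mathcal C}(G,G)=0$ and $\hom^{<0}_{\mathcal C}(L,L)=0$; - $\hom_{\mathcal C}(L,L)$ is finitely generated over $\Bbbk_\Lambda$ with $\hom^0_{\mathcal C}(L,L)\cong\Bbbk_\Lambda$. Put $W=\hom_{\mathcal C}(G,G)$ and $V=\hom_{\mathcal C}(L,L)$. Then the Koszul map $\kappa=\{\kappa_l\}_{l\ge1}$, $\kappa_l:W^{\otimes l}\to(BV)^\vee$, is an $A_\infty$-algebra homomorphism $\kappa:W\to(BV)^\vee$.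
   Context: **Coefficients and filtrations.** $\Lambda=\{\sum_{i\ge 0}a_iT^{\lambda_i}: a_i\in\mathbb{C},\ \lambda_i\in\mathbb{R},\ \lambda_i\to+\infty\}$ with valuation $val$ the smallest exponent with nonzero coefficient; $\Bbbk_\Lambda=\oplus_{i=1}^r\Lambda\pi_i$ with $\pi_i\pi_j=\delta_{ij}\pi_i$; tensor products are over $\Bbbk_\Lambda$. Morphism spaces of $\mathcal C$ between $G$ and $L$ are free $\mathbb Z$-graded $\Bbbk_\Lambda$-bimodules with valuation $\nu$ ($\nu(cX)=val(c)+\nu(X)$ for $c\in\Lambda$, $\nu(X+Y)\ge\min\{\nu(X),\nu(Y)\}$, $\nu(X)=\infty$ iff $X=0$), and the operations $m_k$ ($k\ge 1$, degree $2-k$) are filtered (bounded) and satisfy $\sum(-1)^{|X_1|'+\cdots+|X_i|'}m_{k_1}(X_1,\dots,X_i,m_{k_2}(X_{i+1},\dots),\dots,X_k)=0$ with $|X|'=|X|-1$. Composition is ordered as $m_{l+k+1}:\hom(G,G)^{\otimes l}\otimes\hom(G,L)\otimes\hom(L,L)^{\otimes k}\to\hom(G,L)$. **Generator $P$.** Fix a generator $P$ of $\hom_{\mathcal C}(G,L)=\Bbbk_\Lambda\langle P\rangle$; $\hom_{\mathcal C}(G,L)$ is concentrated in degree $0$, so $|P|=0$ and $m_1(P)=0$. **Bar construction and its dual.** $\bar V=\hom_{\mathcal C}^{>0}(L,L)$ (the kernel of the augmentation of $V$ projecting to $\hom^0_{\mathcal C}(L,L)\cong\Bbbk_\Lambda$).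 $BV=\bigoplus_k(s\bar V)^{\otimes k}$, where $s$ lowers degree by $1$, with differential $d(x_1\otimes\cdots\otimes x_k)=\sum(-1)^{|x_1|'+\cdots+|x_i|'}x_1\otimes\cdots\otimes m_j(x_{i+1},\dots,x_{i+j})\otimes\cdots\otimes x_k$ and the deconcatenation coproduct. $(BV)^\vee=\bigoplus_d((BV)_{-d})^\vee$, where $(-)^\vee$ denotes right $\Bbbk_\Lambda$-linear maps $f$ to $\Bbbk_\Lambda$ that are bounded, i.e. $\inf\{val(f(X)):\nu(X)=0\}>-\infty$. It is a dga with $df=(-1)^{|f|}f\circ d$ and $(f\cdot g)(\mathbf X)=\sum f(g(\mathbf X^{(1)})\mathbf X^{(2)})$ (sum over deconcatenations), regarded as an $A_\infty$-algebra with $M_1(f)=df$, $M_2(f,g)=(-1)^{|f|}f\cdot g$, $M_{\ge3}=0$. **Koszul map.** Let $X_1,\dots,X_N$ freely generate $\bar V$, let $x_1,\dots,x_N\in(BV)^\vee$ be the dual variables (with degree $1-|X_i|$ in $(BV)^\vee$) and $\tilde b=\sum_ix_iX_i$. Then $\kappa_l$ is defined by $$\sum_{k\ge0}m_{l+k+1}(Z_1,\dots,Z_l,P,\underbrace{\tilde b,\dots,\tilde b}_k)=P\,\kappa_l(Z_1,\dots,Z_l),$$ where the left side is expanded by $m(Z_1,\dots,Z_l,P,x_{i_1}X_{i_1},\dots,x_{i_m}X_{i_m})=m(Z_1,\dots,Z_l,P,X_{i_1},\dots,X_{i_m})\,x_{i_m}\cdots x_{i_1}$. Equivalently, $\kappa_l$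 is dual to the pairing $W^{\otimes l}\otimes BV\to\Bbbk_\Lambda$ obtained from the operations $m_{l+k+1}$ above. **$A_\infty$-homomorphism.** A family $\kappa_l$ of filtered maps of degree $1-l$ such that for all $l$ $$M_1(\kappa_l(Z_1,\dots,Z_l))+\sum_{l_1+l_2=l}M_2(\kappa_{l_1}(Z_1,\dots,Z_{l_1}),\kappa_{l_2}(Z_{l_1+1},\dots,Z_l))=\sum(-1)^{|Z_1|'+\cdots+|Z_j|'}\kappa_{k_1}(Z_1,\dots,Z_j,m_{k_2}(Z_{j+1},\dots,Z_{j+k_2}),\dots,Z_l).$$
   Formalization: The Koszul map carries an extra sign (-1)^{|X_1|'+...+|X_k|'} on X_1⊗...⊗X_k, without which the homomorphism equation fails by the sign of M_1; ''filtered'' for the m_k is read as bounded with a constant independent of k. *)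

(* Defs.v *)
From HB Require Import structures.
From mathcomp Require Import all_boot all_order all_algebra.
From mathcomp Require Import complex.
From mathcomp Require Import boolp classical_sets functions cardinality fsbigop.
From mathcomp Require Import reals constructive_ereal ereal.

Set Implicit Arguments.
Unset Strict Implicit.
Unset Printing Implicit Defensive.
Import Order.TTheory GRing.Theory Num.Theory.

Local Open Scope classical_set_scope.
Local Open Scope ring_scope.

(* A series \sum_i a_i T^(l_i) with l_i -> +oo is encoded by its coefficient
   function R -> C: only finitely many exponents lie below any given bound. *)
Section Novikov.
Variable R : realType.

Definition left_finite (a : R -> R[i]) :=
  forall c : R, finite_set [set x | a x != 0 /\ x <= c].

Record novikov := Novikov {
  ncoef :> R -> R[i];
  ncoef_left_finite : left_finite ncoef }.

Implicit Types (a b : novikov) (f g : R -> R[i]).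

HB.instance Definition _ := gen_eqMixin novikov.
HB.instance Definition _ := gen_choiceMixin novikov.

Lemma novikovP a b : ncoef a =1 ncoef b -> a = b.
Proof.
case: a b => [a Ha] [b Hb] /= /funext e.
by move: Ha Hb; rewrite e => Ha Hb; congr Novikov; exact: Prop_irrelevance.
Qed.

Lemma novikov_cover a (c : R) :
  exists2 s : seq R, uniq s & forall x, a x != 0 -> x <= c -> x \in s.
Proof.
have [s hs] := (finite_seqP _).1 (ncoef_left_finite a c).
exists (undup s); first exact: undup_uniq.
move=> x ax xc; rewrite mem_undup.
by have : [set` s] x by rewrite -hs.
Qed.

Lemma novikov_ge a : exists l : R, forall x, a x != 0 -> l <= x.
Proof.
have [s _ hs] := novikov_cover a 0.
have [l [l0 hl]] : exists l : R, l <= 0 /\ forall x, x \in s -> l <= x.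
  elim: s {hs} => [|y s [l [l0 hl]]]; first by exists 0.
  exists (Order.min y l); split; first by rewrite ge_min l0 orbT.
  by move=> x; rewrite inE ge_min => /orP[/eqP ->|/hl ->]; rewrite ?lexx ?orbT.
exists l => x ax; case: (leP x 0) => [x0|/ltW]; first exact/hl/hs.
exact: le_trans.
Qed.

Lemma left_finite_sub a f :
  (forall x, f x != 0 -> a x != 0) -> left_finite f.
Proof.
move=> h c; apply: sub_finite_set (ncoef_left_finite a c).
by move=> x [/h ? ?]; split.
Qed.

Lemma left_finite_add a b : left_finite (fun x => a x + b x).
Proof.
move=> c; apply: sub_finite_set (_ : finite_set
  ([set x | a x != 0 /\ x <= c] `|` [set x | b x != 0 /\ x <= c])).
  move=> x [abx xc]; case: (eqVneq (a x) 0) => ax; last by left.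
  by right; split=> //; rewrite ax add0r in abx.
by rewrite finite_setU; split; exact: ncoef_left_finite.
Qed.

Lemma left_finite_mono (l : R) (z : R[i]) :
  left_finite (fun x => if x == l then z else 0).
Proof.
move=> c; apply: sub_finite_set (finite_set1 l) => x [] /=.
by case: (x =P l) => // _; rewrite eqxx.
Qed.

Definition nmono l z := Novikov (left_finite_mono l z).

Definition nzero := nmono 0 0.
Definition none := nmono 0 1.
Lemma left_finite_opp a : left_finite (fun x => - a x).
Proof. by apply: (@left_finite_sub a) => x; rewrite oppr_eq0. Qed.
Definition nopp a := Novikov (@left_finite_opp a).
Definition nadd a b := Novikov (@left_finite_add a b).

Definition conv f g x : R[i] := \sum_(y \in [set: R]) f y * g (x - y).

Lemma convE f g x (s : seq R) : uniq s ->
  (forall y, f y != 0 -> g (x - y) != 0 -> y \in s) ->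
  conv f g x = \sum_(y <- s) f y * g (x - y).
Proof.
move=> us hs; rewrite /conv (fsbigE s) //.
  by apply: eq_bigl => y; rewrite in_setT.
move=> y _ ys; apply/eqP; rewrite mulf_eq0.
by apply: contraNT ys; rewrite negb_or => /andP[? ?]; exact: hs.
Qed.

Lemma conv_cover a (l c : R) : exists2 s : seq R, uniq s &
  forall g, (forall x, g x != 0 -> l <= x) -> forall x, x <= c ->
  conv a g x = \sum_(y <- s) a y * g (x - y).
Proof.
have [s us hs] := novikov_cover a (c - l).
exists s => // g hg x xc; apply: convE => // y ay /hg.
rewrite lerBrDr -lerBrDl => h; apply: hs => //.
by apply: le_trans h _; rewrite lerB.
Qed.

Lemma conv_neq0 f g x : conv f g x != 0 ->
  exists2 y, f y != 0 & g (x - y) != 0.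
Proof.
move=> h; apply: contrapT => /forall2NP H; move/eqP: h; apply.
rewrite /conv fsbig1 // => y _; have [/negP|/negP] := H y.
  by rewrite negbK => /eqP ->; rewrite mul0r.
by rewrite negbK => /eqP ->; rewrite mulr0.
Qed.

Lemma left_finite_conv a b : left_finite (conv a b).
Proof.
move=> c; have [la hla] := novikov_ge a; have [lb hlb] := novikov_ge b.
have [s us hs] := novikov_cover a (c - lb).
have [t ut ht] := novikov_cover b (c - la).
apply: (@sub_finite_set _ _ [set` [seq y + z | y <- s, z <- t]]); last first.
  exact: finite_seq.
move=> x [/conv_neq0[y ay bxy] xc] /=; apply/allpairsP; exists (y, x - y).
split => /=; last by rewrite subrKC.
- apply: hs => //; have := hlb _ bxy.
  by rewrite lerBrDr -lerBrDl => /le_trans -> //; rewrite lerB.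
- apply: ht => //; have := hla _ ay => h.
  by rewrite lerB.
Qed.

Definition nmul a b := Novikov (@left_finite_conv a b).

Lemma naddA : associative nadd.
Proof. by move=> a b c; apply: novikovP => x /=; rewrite addrA. Qed.
Lemma naddC : commutative nadd.
Proof. by move=> a b; apply: novikovP => x /=; rewrite addrC. Qed.
Lemma nadd0 : left_id nzero nadd.
Proof. by move=> a; apply: novikovP => x /=; case: ifP; rewrite add0r. Qed.
Lemma naddN : left_inverse nzero nopp nadd.
Proof. by move=> a; apply: novikovP => x /=; case: ifP; rewrite addNr. Qed.

HB.instance Definition _ :=
  GRing.isZmodule.Build novikov naddA naddC nadd0 naddN.

Lemma nmulC : commutative nmul.
Proof.
move=> a b; apply: novikovP => x /=.
have [lb hlb] := novikov_ge b.
have [s us hs] := novikov_cover a (x - lb).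
rewrite (@convE a b x s) //; last first.
  move=> y ay /hlb h; apply: hs => //.
  by rewrite lerBrDr -lerBrDl.
rewrite (@convE b a x [seq x - y | y <- s]); first last.
- move=> y by_ ay; apply/mapP; exists (x - y); last by rewrite subKr.
  by apply: hs => //; rewrite lerB ?hlb.
- by rewrite map_inj_uniq // => y z /addrI /oppr_inj.
rewrite big_map; apply: eq_bigr => y _; rewrite subKr mulrC //.
Qed.

Lemma nmulDl : left_distributive nmul nadd.
Proof.
move=> a b c; apply: novikovP => x /=.
have [lc hlc] := novikov_ge c.
have [s us hs] := novikov_cover a (x - lc).
have [t ut ht] := novikov_cover b (x - lc).
have E f : (forall y, f y != 0 -> y <= x - lc -> y \in undup (s ++ t)) ->
   conv f c x = \sum_(y <- undup (s ++ t)) f y * c (x - y).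
  move=> hf; apply: convE; first exact: undup_uniq.
  by move=> y fy /hlc h; apply: hf => //; rewrite lerBrDr -lerBrDl.
rewrite (E a) => [|y ay h]; last by rewrite mem_undup mem_cat hs.
rewrite (E b) => [|y ay h]; last by rewrite mem_undup mem_cat ht ?orbT.
rewrite (E (fun y => a y + b y)) => [|y aby h]; last first.
  rewrite mem_undup mem_cat; case: (eqVneq (a y) 0) => ay; last by rewrite hs.
  by rewrite ht ?orbT //; rewrite ay add0r in aby.
by rewrite -big_split; apply: eq_bigr => y _; rewrite mulrDl.
Qed.

Lemma nmul1 : left_id none nmul.
Proof.
move=> a; apply: novikovP => x /=.
rewrite (@convE _ _ x [:: 0]) //.
  by rewrite big_seq1 /= eqxx mul1r subr0.
by move=> y /=; case: (y =P 0) => [->|_]; rewrite ?inE ?eqxx.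
Qed.

Lemma nmulA : associative nmul.
Proof.
move=> a b c; rewrite (nmulC b c) (nmulC _ c); apply: novikovP => x.
have [la hla] := novikov_ge a; have [lb hlb] := novikov_ge b.
have [lc hlc] := novikov_ge c.
have [s us hs] := novikov_cover a (x - lc - lb).
have [t ut ht] := novikov_cover c (x - la - lb).
have ge_conv f g (lf lg : R) : (forall y, f y != 0 -> lf <= y) ->
    (forall y, g y != 0 -> lg <= y) -> forall y, conv f g y != 0 -> lf + lg <= y.
  by move=> hf hg y /conv_neq0[z fz gz]; rewrite -[y](subrKC z) lerD ?hf ?hg.
have le_sub (u v w : R) : w <= u - v -> v <= u - w.
  by rewrite !lerBrDr addrC.
rewrite /= (@convE _ _ x s) //; last first.
  move=> y ay /(ge_conv _ _ _ _ hlc hlb) /le_sub h; apply: hs => //.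
  by rewrite -addrA -opprD.
rewrite (@convE _ _ x t) //; last first.
  move=> y ay /(ge_conv _ _ _ _ hla hlb) /le_sub h; apply: ht => //.
  by rewrite -addrA -opprD.
transitivity (\sum_(y <- s) \sum_(z <- t) a y * (c z * b (x - y - z))).
  apply: eq_bigr => y _; rewrite -mulr_sumr.
  case: (eqVneq (a y) 0) => [->|ay]; first by rewrite !mul0r.
  congr (_ * _); apply: convE => // z cz /hlb /le_sub h; apply: ht => //.
  by apply: le_trans h _; rewrite !lerB // hla.
rewrite exchange_big /=; apply: eq_bigr => z _.
transitivity (c z * \sum_(y <- s) a y * b (x - z - y)).
  rewrite mulr_sumr; apply: eq_bigr => y _.
  by rewrite mulrCA addrAC.
case: (eqVneq (c z) 0) => [->|cz]; first by rewrite !mul0r.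
congr (_ * _); apply/esym/convE => // y ay /hlb /le_sub h; apply: hs => //.
by apply: le_trans h _; rewrite !lerB // hlc.
Qed.

Lemma none_neq0 : none != nzero.
Proof.
apply/eqP => /(congr1 (fun a : novikov => a 0)) /=; rewrite eqxx => /eqP.
by rewrite oner_eq0.
Qed.

HB.instance Definition _ := GRing.Zmodule_isComNzRing.Build novikov
  nmulA nmulC nmul1 nmulDl none_neq0.

Definition nval a : \bar R := ereal_inf [set x%:E | x in [set x | a x != 0]].

Local Open Scope ereal_scope.

Lemma nval_le a (x : R) : (a x != 0)%R -> nval a <= x%:E.
Proof. by move=> ax; apply: ereal_inf_lbound; exists x. Qed.

Lemma le_nval a (u : \bar R) :
  (forall x, (a x != 0)%R -> u <= x%:E) -> u <= nval a.
Proof. by move=> h; apply/ereal_infP => _ [x ax <-]; exact: h. Qed.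

Lemma nval0 : nval 0%R = +oo.
Proof.
apply/eqP; rewrite -leye_eq; apply: le_nval => x /=.
by case: ifP; rewrite eqxx.
Qed.

Lemma nval_gtNy a : -oo < nval a.
Proof.
have [l hl] := novikov_ge a; apply: (@lt_le_trans _ _ l%:E).
  exact: ltNyr.
by apply: le_nval => x /hl; rewrite lee_fin.
Qed.

Lemma nvalD a b (u : \bar R) : u <= nval a -> u <= nval b -> u <= nval (a + b)%R.
Proof.
move=> ua ub; apply: le_nval => x /= abx.
case: (eqVneq (a x) 0%R) => ax; last exact: le_trans ua (nval_le ax).
by apply: le_trans ub (nval_le _); rewrite ax add0r in abx.
Qed.

Lemma nvalM a b : nval a + nval b <= nval (a * b)%R.
Proof.
apply: le_nval => x /conv_neq0[y ay bxy].
by rewrite -[x](subrKC y) EFinD leeD // nval_le.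
Qed.

Lemma nval_mono (l : R) : nval (nmono l 1%R) = l%:E.
Proof.
apply/eqP; rewrite eq_le nval_le /=; last by rewrite eqxx oner_eq0.
apply: le_nval => x /=; case: (x =P l) => [->|] //; by rewrite eqxx.
Qed.

Lemma nmonoM (l l' : R) : (nmono l 1 * nmono l' 1 = nmono (l + l') 1 :> novikov)%R.
Proof.
apply: novikovP => x /=; rewrite (@convE _ _ x [:: l]) //.
  by rewrite big_seq1 /= eqxx mul1r subr_eq addrC.
by move=> y /=; case: (y =P l) => [->|_]; rewrite ?inE ?eqxx.
Qed.

End Novikov.

Section Chains.
Variables (I : Type) (Q : I -> I -> int -> Type).

(* Composable sequences x_1, ..., x_k of homogeneous morphisms; a chain stands
   for the pure tensor x_1 (x) ... (x) x_k, and multilinear maps on chains for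
   linear maps on the tensor product over k_Lambda. *)
Inductive chain : I -> I -> Type :=
| Cnil i : chain i i
| Ccons i j k d (x : Q i j d) (c : chain j k) : chain i k.

Fixpoint ccat i j k (c : chain i j) : chain j k -> chain i k :=
  match c in chain i j return chain j k -> chain i k with
  | Cnil _ => id
  | Ccons _ _ _ _ x c1 => fun c2 => Ccons x (ccat c1 c2)
  end.

Fixpoint clen i j (c : chain i j) : nat :=
  if c is Ccons _ _ _ _ _ c1 then (clen c1).+1 else 0%N.

(* the degree \sum (|x_i| - 1) in the bar construction *)
Fixpoint sdeg i j (c : chain i j) : int :=
  if c is Ccons _ _ _ d _ c1 then (d - 1) + sdeg c1 else 0.

Fixpoint cpos i j (c : chain i j) : bool :=
  if c is Ccons _ _ _ d _ c1 then (0 < d) && cpos c1 else true.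

Record cut i j := Cut { mid : I; cl : chain i mid; cr : chain mid j }.

(* all deconcatenations c = cl ++ cr, the trivial ones included *)
Fixpoint splits i j (c : chain i j) : seq (cut i j) :=
  match c in chain i j return seq (cut i j) with
  | Cnil i => [:: Cut (Cnil i) (Cnil i)]
  | Ccons _ _ _ _ x c1 => Cut (Cnil _) (Ccons x c1) ::
      [seq Cut (Ccons x (cl s)) (cr s) | s <- splits c1]
  end.

Definition chain1 i j d (x : Q i j d) := Ccons x (Cnil j).
Definition chain2 i j k d e (x : Q i j d) (y : Q j k e) := Ccons x (chain1 y).

Record word := Word { wsrc : I; wtgt : I; wchain :> chain wsrc wtgt }.

Lemma ccatA i j k l (a : chain i j) (b : chain j k) (c : chain k l) :
  ccat (ccat a b) c = ccat a (ccat b c).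
Proof. by elim: a b => //= i' j' k' d x a IH b; rewrite IH. Qed.

Lemma sdeg_ccat i j k (a : chain i j) (b : chain j k) :
  sdeg (ccat a b) = sdeg a + sdeg b.
Proof.
by elim: a b => [? b|i' j' k' d x a IH b] /=; rewrite ?add0r ?IH ?addrA.
Qed.

Lemma clen_ccat i j k (a : chain i j) (b : chain j k) :
  clen (ccat a b) = (clen a + clen b)%N.
Proof. by elim: a b => //= i' j' k' d x a IH b; rewrite IH. Qed.

Lemma cpos_ccat i j k (a : chain i j) (b : chain j k) :
  cpos (ccat a b) = cpos a && cpos b.
Proof. by elim: a b => //= i' j' k' d x a IH b; rewrite IH andbA. Qed.

Lemma sum_splits_mid (M : nmodType) i j k l d (p : chain i k) (x : Q k l d)
    (q : chain l j) (H : forall m, chain i m -> chain m j -> M) :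
  \sum_(s <- splits (ccat p (Ccons x q))) H _ (cl s) (cr s) =
  \sum_(s <- splits p) H _ (cl s) (ccat (cr s) (Ccons x q)) +
  \sum_(s <- splits q) H _ (ccat p (Ccons x (cl s))) (cr s).
Proof.
elim: p x q H => [k'|i' j' k' e y p IH] x q H /=.
  by rewrite big_cons big_map big_seq1.
by rewrite !big_cons !big_map /= (IH _ _ (fun m a b => H m (Ccons y a) b)) addrA.
Qed.

End Chains.
Arguments Cnil {I Q} i.

Fixpoint cmap (I J : Type) (Q : I -> I -> int -> Type) (u : J -> I) i j
    (c : chain (fun a b d => Q (u a) (u b) d) i j) : chain Q (u i) (u j) :=
  match c in chain _ i j return chain Q (u i) (u j) with
  | Cnil i => Cnil (u i)
  | Ccons _ _ _ _ x c1 => Ccons x (cmap c1)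
  end.

(* An A_oo-algebra over k_Lambda = Lambda^r is encoded through its idempotents
   as data indexed by I = 'I_r, mor A i j d being the degree d part of
   pi_i A pi_j.  [mop c e] is the degree e component of m_k (x_1, ..., x_k). *)
Record ainf_data (R : realType) (I : Type) := AinfData {
  mor : I -> I -> int -> lmodType (novikov R);
  hval : forall i j d, mor i j d -> \bar R;
  mop : forall i j, chain (fun a b d => mor a b d) i j ->
    forall e, mor i j e }.

Notation hchain A := (chain (fun a b d => mor A a b d)).
Notation hword A := (word (fun a b d => mor A a b d)).

Section AinfData.
Variables (R : realType) (I : Type) (A : ainf_data R I).
Local Notation Lambda := (novikov R).

Definition nsign (n : int) : Lambda := (-1) ^+ `|n|%N.

Fixpoint cval i j (c : hchain A i j) : \bar R :=
  if c is Ccons _ _ _ _ x c1 then (hval x + cval c1)%E else 0%E.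

Definition multilinear i j (M : lmodType Lambda) (F : hchain A i j -> M) :=
  forall k l d (p : hchain A i k) (q : hchain A l j) (a : Lambda)
         (x y : mor A k l d),
    F (ccat p (Ccons (a *: x + y) q)) =
    a *: F (ccat p (Ccons x q)) + F (ccat p (Ccons y q)).

(* F applied to the bar differential
   \sum (-1)^(|x_1|'+...+|x_i|') x_1 ... m(x_(i+1), ..., x_(i+j)) ... x_k *)
Definition bar_sum i j (M : lmodType Lambda) (F : hchain A i j -> M)
    (c : hchain A i j) : M :=
  \sum_(s <- splits c) \sum_(t <- splits (cr s) | (0 < clen (cl t))%N)
    nsign (sdeg (cl s)) *:
      F (ccat (cl s) (Ccons (mop (cl t) (sdeg (cl t) + 2)) (cr t))).

Definition free_module (M : lmodType Lambda) := exists B : set M,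
  (forall x, exists s : seq (Lambda * M),
     (forall y, y \in s -> B y.2) /\ x = \sum_(y <- s) y.1 *: y.2) /\
  (forall (s : seq M) (a : M -> Lambda), uniq s -> (forall y, y \in s -> B y) ->
     \sum_(y <- s) a y *: y = 0 -> forall y, y \in s -> a y = 0).

Definition free_generator (M : lmodType Lambda) (x : M) :=
  (forall y, exists a, y = a *: x) /\ (forall a, a *: x = 0 -> a = 0).

Record valued : Prop := Valued {
  hval_gtNy : forall i j d (x : mor A i j d), (-oo < hval x)%E;
  hvalZ : forall i j d a (x : mor A i j d), hval (a *: x) = (nval a + hval x)%E;
  hvalD : forall i j d (x y : mor A i j d),
    (Order.min (hval x) (hval y) <= hval (x + y))%E;
  hval_eqy : forall i j d (x : mor A i j d), hval x = +oo%E <-> x = 0 }.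

Definition mop_multilinear :=
  forall i j e, multilinear (fun c : hchain A i j => mop c e).

(* The constant does not depend on the number of inputs; otherwise the
   differential of (BV)^\vee would not preserve bounded functionals, since
   (s V^1)^(x)k lies in degree 0 of BV for every k. *)
Definition mop_bounded := exists r : R, forall i j (c : hchain A i j) e,
  (0 < clen c)%N -> (r%:E + cval c <= hval (mop c e))%E.

Record filtered : Prop := Filtered {
  filtered_valued : valued;
  filtered_multilinear : mop_multilinear;
  filtered_bounded : mop_bounded }.

Record strict_unit i (u : mor A i i 0) : Prop := StrictUnit {
  unit_m1 : forall e, mop (chain1 u) e = 0;
  unit_m2l : forall j d (x : mor A i j d), mop (chain2 u x) d = x;
  unit_m2r : forall j d (x : mor A j i d), mop (chain2 x u) d = nsign d *: x;
  unit_mk : forall j k (p : hchain A j i) (q : hchain A i k) e,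
    (2 <= clen p + clen q)%N -> mop (ccat p (Ccons u q)) e = 0 }.

End AinfData.

Definition subcat (R : realType) (I J : Type) (A : ainf_data R I) (u : J -> I) :
    ainf_data R J :=
  {| mor := fun i j d => mor A (u i) (u j) d;
     hval := fun i j d x => hval x;
     mop := fun i j c e => mop (cmap (Q := fun a b d => mor A a b d) c) e |}.

Record ainf_axioms (R : realType) (I : Type) (A : ainf_data R I) : Prop :=
  AinfAxioms {
  ainf_free : forall i j d, free_module (mor A i j d);
  ainf_valued : valued A;
  ainf_multilinear : mop_multilinear A;
  ainf_degree : forall i j (c : hchain A i j) e,
    e != sdeg c + 2 -> mop c e = 0;
  ainf_bounded : forall (J : finType) (u : J -> I), mop_bounded (subcat A u);
  ainf_relation : forall i j (c : hchain A i j) e,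
    bar_sum (fun c' => mop c' e) c = 0;
  ainf_unital : forall i, exists u : mor A i i 0, strict_unit u }.

Record ainf_cat (R : realType) := AinfCat {
  Ob : Type;
  cat_data :> ainf_data R Ob;
  cat_axioms : ainf_axioms cat_data }.

Section Subcat.
Variables (R : realType) (I J : Type) (A : ainf_data R I) (u : J -> I).
Local Notation cm := (cmap (Q := fun a b d => mor A a b d) (u := u)).

Lemma cmap_ccat i j k (c : hchain (subcat A u) i j) (c' : hchain (subcat A u) j k) :
  cm (ccat c c') = ccat (cm c) (cm c').
Proof. by elim: c c' => //= i' j' k' d x c IH c'; rewrite IH. Qed.

Lemma sdeg_cmap i j (c : hchain (subcat A u) i j) : sdeg (cm c) = sdeg c.
Proof. by elim: c => //= i' j' k' d x c ->. Qed.

Lemma cval_cmap i j (c : hchain (subcat A u) i j) : cval (cm c) = cval c.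
Proof. by elim: c => //= i' j' k' d x c ->. Qed.

Lemma subcat_valued : valued A -> valued (subcat A u).
Proof. by case=> h1 h2 h3 h4; split => *; [exact: h1|exact: h2|exact: h3|exact: h4]. Qed.

Lemma subcat_multilinear : mop_multilinear A -> mop_multilinear (subcat A u).
Proof. by move=> h i j e k l d p q a x y /=; rewrite !cmap_ccat h. Qed.

End Subcat.

Lemma subcat_filtered (R : realType) (C : ainf_cat R) (J : finType)
  (u : J -> Ob C) : filtered (subcat C u).
Proof.
have h := cat_axioms C; split; [apply: subcat_valued|apply: subcat_multilinear|].
- exact: ainf_valued h.
- exact: ainf_multilinear h.
- exact: ainf_bounded h _ u.
Qed.

Arguments subcat_filtered {R} C {J} u.

Section Multilinear.
Variables (R : realType) (I : Type) (A : ainf_data R I).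
Local Notation Lambda := (novikov R).

Lemma cval_ccat i j k (a : hchain A i j) (b : hchain A j k) :
  cval (ccat a b) = (cval a + cval b)%E.
Proof. by elim: a b => [? b|i' j' k' d x c IH b] /=; rewrite ?add0e ?IH ?addeA. Qed.

Lemma multilinear0 i j (M : lmodType Lambda) (F : hchain A i j -> M) k l d
    (p : hchain A i k) (q : hchain A l j) :
  multilinear F -> F (ccat p (Ccons (0 : mor A k l d) q)) = 0.
Proof.
move=> h; have := h k l d p q 1 0 0; rewrite !scale1r addr0 => /esym/eqP.
by rewrite -subr_eq0 addrK => /eqP.
Qed.

Lemma multilinearZ i j (M : lmodType Lambda) (F : hchain A i j -> M) k l d
    (p : hchain A i k) (q : hchain A l j) a (x : mor A k l d) :
  multilinear F -> F (ccat p (Ccons (a *: x) q)) = a *: F (ccat p (Ccons x q)).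
Proof. by move=> h; rewrite -[a *: x]addr0 h multilinear0 // addr0. Qed.

Lemma multilinear_splits i j (M : lmodType Lambda)
    (H : forall m, hchain A i m -> hchain A m j -> M) :
  (forall m b, multilinear (fun a => H m a b)) ->
  (forall m a, multilinear (fun b => H m a b)) ->
  multilinear (fun c => \sum_(s <- splits c) H _ (cl s) (cr s)).
Proof.
move=> Hl Hr k l d p q a x y; rewrite !sum_splits_mid scalerDr addrACA.
rewrite !scaler_sumr -!big_split /=.
by congr (_ + _); apply: eq_bigr => s _; rewrite ?Hl ?Hr.
Qed.

Lemma multilinear_bar_sum i j (M : lmodType Lambda) (F : hchain A i j -> M) :
  mop_multilinear A -> multilinear F -> multilinear (bar_sum F).
Proof.
move=> hA hF.
pose H2 n (a : hchain A i n) m (b : hchain A n m) (c : hchain A m j) : M :=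
  if (0 < clen b)%N then nsign R (sdeg a) *:
    F (ccat a (Ccons (mop b (sdeg b + 2)) c)) else 0.
have -> : bar_sum F = fun c => \sum_(s <- splits c)
    \sum_(t <- splits (cr s)) H2 _ (cl s) _ (cl t) (cr t).
  by apply/funext => c; apply: eq_bigr => s _; rewrite big_mkcond.
have H2r n a m b : multilinear (@H2 n a m b).
  move=> k l d p q e x y; rewrite /H2; case: ifP => _; last by rewrite scaler0 addr0.
  set z := mop _ _.
  have E t : ccat a (Ccons z (ccat p (Ccons t q))) =
             ccat (ccat a (Ccons z p)) (Ccons t q) by rewrite ccatA.
  by rewrite !E hF scalerDr !scalerA mulrC.
apply: (multilinear_splits (H := fun m a c =>
    \sum_(t <- splits c) H2 _ a _ (cl t) (cr t))).
  move=> m b k l d p q e x y; rewrite scaler_sumr -big_split /=.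
  apply: eq_bigr => t _; rewrite /H2; case: ifP => _; last by rewrite scaler0 addr0.
  by rewrite !ccatA /= hF !sdeg_ccat /= scalerDr !scalerA mulrC.
move=> m a; apply: multilinear_splits => // n b k l d p q e x y.
rewrite /H2 !clen_ccat /= !addnS !ltnS !leq0n.
rewrite !sdeg_ccat /=; set D := _ + 2.
rewrite hA hF scalerDr !scalerA mulrC //.
Qed.

End Multilinear.

Section Dual.
Variables (R : realType) (I : eqType) (V : ainf_data R I).
Local Notation Lambda := (novikov R).
Implicit Types (f g : hword V -> Lambda^o) (w : hword V).

(* Functionals on BV, given on pure tensors and extended by 0 outside
   Vbar = V^{>0}.  [dual_mem i j p] singles out pi_i (BV)^\vee_p pi_j, that is,
   the bounded functionals supported on pi_j (BV)_(-p) pi_i.  A pure tensor has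
   valuation \sum nu(x_i), and BV the valuation this induces (the supremum over
   decompositions of the minimum over terms), so that boundedness can be tested
   on pure tensors. *)
Definition dual_supp i j (p : int) (w : hword V) :=
  [&& wsrc w == j, wtgt w == i, cpos w & sdeg w == - p].

Definition dual_val f : \bar R :=
  ereal_inf [set nval (f w) | w in [set w : hword V | cval w = 0%E]].

Definition dual_mem i j p f : Prop :=
  [/\ forall a b, multilinear (fun c : hchain V a b => f (Word c)),
      forall w, ~~ dual_supp i j p w -> f w = 0 &
      (-oo < dual_val f)%E].

Definition dual_pred i j p : {pred (hword V -> Lambda^o)} :=
  fun f => `[< dual_mem i j p f >].

Lemma dual_val_le f w : cval w = 0%E -> (dual_val f <= nval (f w))%E.
Proof. by move=> hw; apply: ereal_inf_lbound; exists w. Qed.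

Lemma dual_submod i j p : submod_closed (dual_pred i j p).
Proof.
split.
  apply/asboolP; split => //; first by move=> a b k l d *; rewrite scaler0 addr0.
  have h : (+oo <= dual_val 0%R)%E.
    by apply/ereal_infP => _ [w _ <-]; rewrite nval0.
  exact: lt_le_trans h.
move=> a f g /asboolP[fm fs fb] /asboolP[gm gs gb]; apply/asboolP; split.
- move=> k l b m d s t c x y; rewrite !fctE fm gm !scalerDr !scalerA mulrC.
  by rewrite addrACA.
- by move=> w hw; rewrite !fctE fs // gs // scaler0 addr0.
have [r hr] : exists r : R, (r%:E <= nval a + dual_val f)%E /\
    (r%:E <= dual_val g)%E.
  have ex u : (-oo < u)%E -> exists r : R, (r%:E <= u)%E.
    by case: u => // [r _|_]; [exists r|exists 0; rewrite leey].
  have /ex[r hr] : (-oo < nval a + dual_val f)%E.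
    by rewrite ltNye adde_eq_ninfty negb_or -!ltNye nval_gtNy.
  have /ex[s hs] := gb; exists (Order.min r s); split.
    by apply: le_trans hr; rewrite lee_fin ge_min lexx.
  by apply: le_trans hs; rewrite lee_fin ge_min lexx orbT.
apply: (@lt_le_trans _ _ r%:E); first exact: ltNyr.
apply/ereal_infP => _ [w hw <-]; rewrite !fctE; apply: nvalD.
  apply: le_trans hr.1 (le_trans _ (nvalM _ _)).
  by apply: leeD => //; exact: dual_val_le.
by apply: le_trans hr.2 _; exact: dual_val_le.
Qed.

Section Type_of.
Variables (i j : I) (p : int).

Record bdual := BDual {
  bdual_fun :> hword V -> Lambda^o;
  bdual_funP : bdual_fun \in dual_pred i j p }.

HB.instance Definition _ := [isSub for bdual_fun].
HB.instance Definition _ := [Choice of bdual by <:].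
HB.instance Definition _ := GRing.isSubmodClosed.Build _ _ (dual_pred i j p)
  (dual_submod i j p).
HB.instance Definition _ := [SubChoice_isSubLmodule of bdual by <:].
End Type_of.

Lemma bdualP i j p (f : bdual i j p) : dual_mem i j p f.
Proof. by apply/asboolP/bdual_funP. Qed.

(* the component of a functional in pi_i (BV)^\vee_p pi_j *)
Definition dual_res i j p f : hword V -> Lambda^o :=
  fun w => if dual_supp i j p w then f w else 0.

Hypothesis HV : filtered V.

Lemma cval_gtNy i j (c : hchain V i j) : (-oo < cval c)%E.
Proof.
elim: c => //= i' j' k' d x c IH.
rewrite ltNye adde_eq_ninfty negb_or -!ltNye IH andbT.
exact: hval_gtNy (filtered_valued HV) _ _ _ _.
Qed.

Lemma multilinear_cval_y i j (M : lmodType Lambda) (F : hchain V i j -> M) c :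
  multilinear F -> cval c = +oo%E -> F c = 0.
Proof.
move=> hF; suff : cval c = +oo%E -> exists k l d (p : hchain V i k)
    (q : hchain V l j), c = ccat p (Ccons (0 : mor V k l d) q).
  by move=> h /h[k [l [d [p [q ->]]]]]; exact: multilinear0.
elim: c {F hF} => //= i' j' k' d x c IH h.
have [/(hval_eqy (filtered_valued HV)) ->|xy] := eqVneq (hval x) +oo%E.
  by exists i', j', d, (Cnil i'), c.
have {}/IH[k [l [e [p [q ->]]]]] : cval c = +oo%E.
  move: h xy (hval_gtNy (filtered_valued HV) x).
  by case: (hval x) => // r; case: (cval c).
by exists k, l, e, (Ccons x p), q.
Qed.

Lemma dual_val_bound f :
  (forall a b, multilinear (fun c : hchain V a b => f (Word c))) ->
  (-oo < dual_val f)%E ->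
  exists r : R, forall w, (r%:E + cval w <= nval (f w))%E.
Proof.
move=> hf hb.
have [r hr] : exists r : R, (r%:E <= dual_val f)%E.
  by case: (dual_val f) hb => // [r|] _; [exists r|exists 0; rewrite leey].
exists r => -[i j c] /=.
have [cy|cy] := eqVneq (cval c) +oo%E.
  by rewrite (multilinear_cval_y (hf i j) cy) nval0 leey.
have [v hv] : exists v : R, cval c = v%:E.
  by move: cy (cval_gtNy c); case: (cval c) => // v _ _; exists v.
case: c cy hv => [k|i' j' k d x c] _ hv.
  rewrite /= adde0; apply: le_trans hr _; exact: dual_val_le.
have h0 : cval (Ccons (nmono (- v) 1 *: x) c) = 0%E.
  rewrite /= (hvalZ (filtered_valued HV)) nval_mono -addeA.
  by move: hv => /= ->; rewrite -EFinD addNr.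
have := dual_val_le f (w := Word (Ccons (nmono (- v) 1 *: x) c)) h0.
rewrite (multilinearZ (Cnil i') c _ _ (hf _ _)) /= => h1.
have -> : f (Word (Ccons x c)) =
    nmono v 1 * (nmono (- v) 1 * f (Word (Ccons x c)) : Lambda) :> Lambda.
  by rewrite mulrA nmonoM subrr mul1r.
apply: le_trans (nvalM _ _); rewrite nval_mono addeC -hv.
by apply: leeD => //; exact: le_trans hr h1.
Qed.

Lemma dual_val_gtNy f (r : R) :
  (forall w, (r%:E + cval w <= nval (f w))%E) -> (-oo < dual_val f)%E.
Proof.
move=> h; apply: (@lt_le_trans _ _ r%:E); first exact: ltNyr.
by apply/ereal_infP => _ [w hw <-]; have := h w; rewrite hw adde0.
Qed.

Lemma dual_res_mem i j p f (r : R) :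
  multilinear (fun c : hchain V j i => f (Word c)) ->
  (forall w, dual_supp i j p w -> (r%:E + cval w <= nval (f w))%E) ->
  dual_res i j p f \in dual_pred i j p.
Proof.
move=> hf hb; apply/asboolP; split.
- move=> a b k l d s t c x y; rewrite /dual_res /dual_supp /=.
  rewrite !cpos_ccat !sdeg_ccat /=; case: ifP => [|_]; last first.
    by rewrite scaler0 addr0.
  by move=> /and4P[/eqP e1 /eqP e2 _ _]; subst; exact: hf.
- by move=> w hw; rewrite /dual_res (negbTE hw).
apply: (@dual_val_gtNy _ r) => w; rewrite /dual_res; case: ifP => [/hb//|_].
by rewrite nval0 leey.
Qed.

Lemma nval_nsign n (a : Lambda) (u : \bar R) :
  (u <= nval a -> u <= nval (nsign R n * a)%R)%E.
Proof.
move=> h; rewrite /nsign -signr_odd; case: odd; last by rewrite mul1r.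
rewrite mulN1r; apply: le_nval => x /= ax; apply: le_trans h (nval_le _).
by rewrite -oppr_eq0.
Qed.

Lemma nval_sum_splits i j (c : hchain V i j)
    (H : forall m, hchain V i m -> hchain V m j -> Lambda^o) (u : \bar R) :
  (forall m a b, ccat a b = c -> (u <= nval (H m a b))%E) ->
  (u <= nval (\sum_(s <- splits c) H _ (cl s) (cr s))%R)%E.
Proof.
elim: c H => [k|i' j' k' d x c IH] H h /=; first by rewrite big_seq1 h.
rewrite big_cons big_map; apply: nvalD; first exact: h.
by apply: (IH (fun m a b => H m (Ccons x a) b)) => m a b e; apply: h; rewrite /= e.
Qed.

(* M_1 f = (-1)^|f| f \o d, for f of degree p *)
Definition dual_d i j p (f : bdual i j p) : hword V -> Lambda^o :=
  fun w => nsign R p *: bar_sum (fun c => f (Word c)) (wchain w).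

(* M_2 (f, g) (X) = (-1)^|f| \sum f (g (X^(1)) X^(2)), for f of degree p *)
Definition dual_mul i j k p q (f : bdual i j p) (g : bdual j k q) :
    hword V -> Lambda^o :=
  fun w => nsign R p *: \sum_(s <- splits (wchain w))
    ((g (Word (cl s)) : Lambda) * (f (Word (cr s)) : Lambda) : Lambda^o).

Lemma dual_d_mem i j p (f : bdual i j p) e :
  dual_res i j e (dual_d f) \in dual_pred i j e.
Proof.
have [fm fs fb] := bdualP f; have [r hr] := dual_val_bound fm fb.
have [r' hr'] := filtered_bounded HV.
apply: (@dual_res_mem _ _ _ _ (r + r')).
  move=> k l d s t a x y; rewrite /dual_d /=.
  rewrite (multilinear_bar_sum (filtered_multilinear HV) (fm j i)).
  by rewrite scalerDr !scalerA mulrC.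
move=> [a b c] _ /=; apply: nval_nsign.
apply: (nval_sum_splits (H := fun m a b => \sum_(t <- splits b |
  (0 < clen (cl t))%N) nsign R (sdeg a) *: f (Word (ccat a
    (Ccons (mop (cl t) (sdeg (cl t) + 2)) (cr t)))))) => m x y /= <-.
rewrite big_mkcond.
apply: (nval_sum_splits (H := fun n y z => if (0 < clen y)%N then
  nsign R (sdeg x) *: f (Word (ccat x (Ccons (mop y (sdeg y + 2)) z))) else 0)).
move=> n {}y z /= <-; case: ifP => [hy|_]; last by rewrite nval0 leey.
apply: nval_nsign; apply: le_trans (hr _) => /=; rewrite !cval_ccat /=.
rewrite EFinD -addeA; apply: leeD => //; rewrite addeCA; apply: leeD => //.
by rewrite addeA; apply: leeD => //; exact: hr'.
Qed.

Lemma dual_mul_mem i j k p q (f : bdual i j p) (g : bdual j k q) e :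
  dual_res i k e (dual_mul f g) \in dual_pred i k e.
Proof.
have [fm fs fb] := bdualP f; have [r hr] := dual_val_bound fm fb.
have [gm gs gb] := bdualP g; have [r' hr'] := dual_val_bound gm gb.
apply: (@dual_res_mem _ _ _ _ (r' + r)).
  move=> k' l d s t a x y; rewrite /dual_mul /=.
  rewrite (@multilinear_splits _ _ V k i Lambda^o (fun m a b =>
    (g (Word a) : Lambda) * (f (Word b) : Lambda) : Lambda^o)).
  - by rewrite scalerDr !scalerA mulrC.
  - move=> m b k2 l2 d2 s2 t2 a2 x2 y2; rewrite gm.
    by rewrite [LHS]mulrDl -[in LHS]mulrA.
  - move=> m b k2 l2 d2 s2 t2 a2 x2 y2; rewrite fm.
    by rewrite [LHS]mulrDr [in LHS]mulrCA.
move=> [a b c] _ /=; apply: nval_nsign.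
apply: (nval_sum_splits (H := fun m a b =>
    (g (Word a) : Lambda) * (f (Word b) : Lambda) : Lambda^o)) => m x y /= <-.
apply: le_trans (nvalM _ _); rewrite cval_ccat EFinD addeACA.
by apply: leeD; [exact: (hr' (Word x))|exact: (hr (Word y))].
Qed.

Definition dual_m1 i j p (f : bdual i j p) e : bdual i j e :=
  BDual (dual_d_mem f e).

Definition dual_m2 i j k p q (f : bdual i j p) (g : bdual j k q) e :
  bdual i k e := BDual (dual_mul_mem f g e).

Definition dual_mop i j (c : chain bdual i j) e : bdual i j e :=
  match c in chain _ i j return bdual i j e with
  | Cnil _ => 0
  | Ccons i k j p x c1 =>
    match c1 in chain _ k j return bdual i k p -> bdual i j e with
    | Cnil _ => fun y => dual_m1 y e
    | Ccons k l j q x' c2 =>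
      match c2 in chain _ l j return
        bdual k l q -> bdual i k p -> bdual i j e with
      | Cnil _ => fun z y => dual_m2 y z e
      | Ccons _ _ _ _ _ _ => fun _ _ => 0
      end x'
    end x
  end.

Definition bar_dual : ainf_data R I :=
  {| mor := fun i j p => bdual i j p;
     hval := fun i j p x => dual_val x;
     mop := dual_mop |}.

End Dual.

Section AinfHom.
Variables (R : realType) (I : Type) (A B : ainf_data R I).
Variable kappa : forall i j, hchain A i j -> forall p, mor B i j p.

(* [kappa c p] is the degree p component of kappa_l (x_1, ..., x_l); the target
   B is a dga, viewed as an A_oo-algebra with M_k = 0 for k >= 3. *)
Record ainf_hom : Prop := AinfHom {
  ainf_hom_multilinear : forall i j p,
    multilinear (fun c : hchain A i j => kappa c p);
  ainf_hom_degree : forall i j (c : hchain A i j) p,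
    p != sdeg c + 1 -> kappa c p = 0;
  ainf_hom_bounded : exists r : R, forall i j (c : hchain A i j) p,
    (0 < clen c)%N -> (r%:E + cval c <= hval (kappa c p))%E;
  ainf_hom_relation : forall i j (c : hchain A i j) e, (0 < clen c)%N ->
    mop (chain1 (kappa c (sdeg c + 1)) : hchain B i j) e +
    \sum_(s <- splits c | (0 < clen (cl s))%N && (0 < clen (cr s))%N)
      mop (chain2 (kappa (cl s) (sdeg (cl s) + 1))
                  (kappa (cr s) (sdeg (cr s) + 1)) : hchain B i j) e =
    bar_sum (fun c' => kappa c' e) c }.

End AinfHom.

Section Koszul.
Variables (R : realType) (C : ainf_cat R) (r : nat) (G L : 'I_r -> Ob C).
Local Notation Lambda := (novikov R).
Local Notation W := (subcat C G).
Local Notation V := (subcat C L).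

(* P i j is the component in hom (G_i, L_j) of P in hom (G, L). *)
Variable P : forall i j, mor C (G i) (L j) 0.

(* A W-module structure on k_Lambda (concentrated in degree 0, with W in
   degrees <= 0) is an augmentation of W. *)
Record augmentation (eps : forall i j, mor W i j 0 -> Lambda) : Prop :=
  Augmentation {
  aug_linear : forall i j a (x y : mor W i j 0),
    eps i j (a *: x + y) = a * eps i j x + eps i j y;
  aug_diag : forall i j (x : mor W i j 0), i != j -> eps i j x = 0;
  aug_unit : forall i (u : mor W i i 0), strict_unit u -> eps i i u = 1;
  aug_m1 : forall i j (x : mor W i j (-1)),
    eps i j (mop (chain1 x : hchain W i j) 0) = 0;
  aug_m2 : forall i j k (x : mor W i j 0) (y : mor W j k 0),
    eps i k (mop (chain2 x y : hchain W i k) 0) = eps i j x * eps j k y }.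

(* P generates hom (G, L), whence hom (G, L) ~ k_Lambda, as W-modules. *)
Record module_generator : Prop := ModuleGenerator {
  gen_zero : forall i j d (x : mor C (G i) (L j) d),
    (i != j) || (d != 0) -> x = 0;
  gen_free : forall i, free_generator (P i i);
  gen_module : exists2 eps : forall i j, mor W i j 0 -> Lambda,
    augmentation eps & forall i j k (z : mor W i j 0),
    mop (chain2 (z : mor C (G i) (G j) 0) (P j k) :
      hchain C (G i) (L k)) 0 = eps i j z *: P i k }.

Definition gen_coef i j (y : mor C (G i) (L j) 0) : Lambda :=
  xget 0 [set a | y = a *: P i j].

Definition koszul_chain i j (z : hchain W i j) (w : hword V) :
    hchain C (G i) (L (wtgt w)) :=
  ccat (cmap (Q := fun a b d => mor C a b d) z)
    (Ccons (P j (wsrc w)) (cmap (Q := fun a b d => mor C a b d) (wchain w))).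

(* The word x_(i_m) ... x_(i_1) in the dual variables takes the value
   (-1)^(|X_(i_1)|'+...+|X_(i_m)|') on X_(i_1) (x) ... (x) X_(i_m), by the
   Koszul rule x_i (s X_i) = (-1)^|x_i| for the degree -1 shift s.  With
   x_i (s X_i) = 1 instead, kappa_1 would intertwine m_1 with - M_1. *)
Definition koszul_fun i j (z : hchain W i j) : hword V -> Lambda^o :=
  fun w => nsign R (sdeg w) * gen_coef (mop (koszul_chain z w) 0).

Hypothesis HP : module_generator.

Lemma gen_coefE i (y : mor C (G i) (L i) 0) : y = gen_coef y *: P i i.
Proof.
have [+ _] := gen_free HP i => /(_ y)[a ha].
exact: (@xgetI _ 0 [set a | y = a *: P i i] a ha).
Qed.

Lemma gen_coef_unique i (y : mor C (G i) (L i) 0) a :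
  y = a *: P i i -> gen_coef y = a.
Proof.
move=> ya; have [_ h] := gen_free HP i; apply/eqP; rewrite -subr_eq0.
by apply/eqP/h; rewrite scalerBl -gen_coefE ya subrr.
Qed.

Lemma cmap_comp (I J K : Type) (Q : I -> I -> int -> Type) (u : J -> I)
    (v : K -> J) i j (c : chain (fun a b d => Q (u (v a)) (u (v b)) d) i j) :
  cmap (Q := Q) (cmap (Q := fun a b d => Q (u a) (u b) d) c) =
  cmap (Q := Q) (u := fun x => u (v x)) c.
Proof. by elim: c => //= i' j' k d x c ->. Qed.

Lemma koszul_mem i j (z : hchain W i j) p :
  dual_res i j p (koszul_fun z) \in dual_pred i j p.
Proof.
have HC := cat_axioms C; have HV := ainf_valued HC.
pose u (s : 'I_r + 'I_r) := match s with inl a => G a | inr a => L a end.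
have [rho hrho] := ainf_bounded HC u.
have bound (c : hchain V j i) : (rho%:E + (cval z + (hval (P j j) + cval c)) <=
    nval (gen_coef (mop (koszul_chain z (Word c)) 0)) + hval (P i i))%E.
  rewrite -(hvalZ HV) -gen_coefE.
  pose zu : hchain (subcat C u) (inl i) (inl j) :=
    cmap (Q := fun a b d => mor (subcat C u) a b d) (u := inl) z.
  pose cu : hchain (subcat C u) (inr j) (inr i) :=
    cmap (Q := fun a b d => mor (subcat C u) a b d) (u := inr) c.
  pose Pu : mor (subcat C u) (inl j) (inr j) 0 := P j j.
  have := hrho _ _ (ccat zu (Ccons Pu cu)) 0.
  rewrite clen_ccat /= addnS => /(_ isT).
  rewrite -!(cval_cmap (A := C)) cmap_ccat /=.
  rewrite (cmap_comp (Q := fun a b d => mor C a b d) (u := u) (v := inl)).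
  rewrite (cmap_comp (Q := fun a b d => mor C a b d) (u := u) (v := inr)).
  by rewrite cval_ccat.
have [pi hpi] : exists t : R, hval (P i i) = t%:E.
  move: (hval_gtNy HV (P i i)) (hval_eqy HV (P i i)).
  case: (hval (P i i)) => // [t _ _|_ [/(_ erefl) P0 _]]; first by exists t.
  have [_ /(_ 1)] := gen_free HP i; rewrite P0 scaler0 => /(_ erefl) /eqP.
  by rewrite oner_eq0.
have ex t : (-oo < t)%E -> exists s : R, (s%:E <= t)%E.
  by case: t => // [s _|_]; [exists s|exists 0; rewrite leey].
have /ex[a ha] := cval_gtNy (subcat_filtered C G) z.
have /ex[b hb] := hval_gtNy HV (P j j).
apply: (@dual_res_mem _ _ _ _ _ _ _ (rho + a + b - pi)).
  move=> k l d s t e x y; rewrite /koszul_fun !sdeg_ccat /=.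
  rewrite -[e *: (_ : Lambda^o)]/(e * _ : Lambda) mulrCA -mulrDr.
  congr (_ * _); apply: gen_coef_unique; rewrite scalerDl -scalerA -!gen_coefE.
  rewrite /koszul_chain /= !cmap_ccat /=.
  have E v : ccat (cmap (Q := fun a b d => mor C a b d) z) (Ccons (P j j)
      (ccat (cmap s) (Ccons v (cmap t)))) =
    ccat (ccat (cmap (Q := fun a b d => mor C a b d) z) (Ccons (P j j)
      (cmap s))) (Ccons (v : mor C (L k) (L l) d) (cmap t)) by rewrite ccatA.
  by rewrite !E (ainf_multilinear HC).
move=> [j' i' c] /and4P[/= /eqP ej /eqP ei _ _]; subst j' i'.
apply: nval_nsign; have := bound c; rewrite hpi -leeBlDr // => h.
apply: le_trans h; rewrite leeBrDr // addeAC -EFinD subrK !EFinD -!addeA.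
by rewrite leeD // leeD // leeD.
Qed.

Definition koszul i j (z : hchain W i j) p :
    mor (bar_dual (subcat_filtered C L)) i j p :=
  BDual (koszul_mem z p).

End Koszul.

Section FinitelyGenerated.
Variables (R : realType) (I : Type) (A : ainf_data R I).

Record helt := HElt {
  hsrc : I; htgt : I; hdeg : int; helt_val : mor A hsrc htgt hdeg }.

(* generated over k_Lambda by finitely many homogeneous elements *)
Definition finitely_generated := exists (n : nat) (g : 'I_n -> helt),
  forall U : (forall i j d, set (mor A i j d)),
    (forall i j d, U i j d 0 /\ forall a x y,
       U i j d x -> U i j d y -> U i j d (a *: x + y)) ->
    (forall k, U _ _ _ (helt_val (g k))) ->
  forall i j d x, U i j d x.

End FinitelyGenerated.

(* Main.v *)
(* Write the A_oo relation of C on the composable sequence Z, P, X with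
   Z in W^(x)l and X in BV.  Its terms are of three kinds: the inner operation
   only sees entries of Z, only sees entries of X, or sees P.  Divided by P, the
   first kind is the pairing with X of the right-hand side of the homomorphism
   relation and the second that of M_1 (kappa (Z)).  In the third kind the inner
   operation returns a multiple of P, so the term is a product of two values of
   kappa and the sum is the M_2 part; its terms in which one of the two
   arguments from Z is empty vanish, because X has degree >= 0 in the shifted
   grading of BV.  The factor (-1)^|X| in the definition of kappa turns the signs
   of the A_oo relation into those of the homomorphism relation. *)
Require Import Defs.
From HB Require Import structures.
From mathcomp Require Import all_boot all_order all_algebra.
From mathcomp Require Import boolp classical_sets functions reals.
From mathcomp Require Import constructive_ereal ereal.
From mathcomp Require Import zify lra.

Set Implicit Arguments.
Unset Strict Implicit.
Unset Printing Implicit Defensive.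
Import Order.TTheory GRing.Theory Num.Theory.

Local Open Scope ring_scope.

(** * Sums over deconcatenations of a chain into two or three pieces *)

Section Splits.
Variables (I : Type) (Q : I -> I -> int -> Type) (M : nmodType).

Lemma sum_splits_cmap (J : Type) (u : J -> I) i j
    (c : chain (fun a b d => Q (u a) (u b) d) i j)
    (H : forall m, chain Q (u i) m -> chain Q m (u j) -> M) :
  \sum_(s <- splits (cmap c)) H _ (cl s) (cr s) =
  \sum_(s <- splits c) H _ (cmap (cl s)) (cmap (cr s)).
Proof.
elim: c H => [k|i' j' k d x c IH] H /=; first by rewrite !big_seq1.
by rewrite !big_cons !big_map /= (IH (fun m a b => H m (Ccons x a) b)).
Qed.

(** Plain extensionality of sums forgets that the two pieces concatenate to [c]; the degree and
    positivity arguments below need this information. *)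
Lemma eq_big_splits i j (c : chain Q i j)
    (H H' : forall m, chain Q i m -> chain Q m j -> M) :
  (forall m a b, ccat a b = c -> H m a b = H' m a b) ->
  \sum_(s <- splits c) H _ (cl s) (cr s) =
  \sum_(s <- splits c) H' _ (cl s) (cr s).
Proof.
elim: c H H' => [k|i' j' k d x c IH] H H' e /=; first by rewrite !big_seq1 e.
rewrite !big_cons !big_map /= e //; congr (_ + _).
apply: (IH (fun m a b => H m (Ccons x a) b) (fun m a b => H' m (Ccons x a) b)).
by move=> m a b ab; apply: e; rewrite /= ab.
Qed.

(** The iterated coproduct. The cut points are arguments of [H] because the types of the pieces
    depend on them. *)
Definition trisum i j (c : chain Q i j)
    (H : forall m n, chain Q i m -> chain Q m n -> chain Q n j -> M) :=
  \sum_(s <- splits c) \sum_(t <- splits (cr s)) H _ _ (cl s) (cl t) (cr t).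

Lemma eq_trisum i j (c : chain Q i j)
    (H H' : forall m n, chain Q i m -> chain Q m n -> chain Q n j -> M) :
  (forall m n a b b', ccat a (ccat b b') = c -> H m n a b b' = H' m n a b b') ->
  trisum c H = trisum c H'.
Proof.
move=> e; apply: (eq_big_splits
  (H := fun m a b => \sum_(t <- splits b) H _ _ a (cl t) (cr t))
  (H' := fun m a b => \sum_(t <- splits b) H' _ _ a (cl t) (cr t))).
move=> m a b ab; apply: (eq_big_splits (H := fun n b b' => H m n a b b')
  (H' := fun n b b' => H' m n a b b')).
by move=> n b1 b2 bb; apply: e; rewrite bb.
Qed.

(** The marked entry [x] falls in the last, the middle or the first of the three pieces, which gives
    the three summands in this order. For [x] equal to $P$ they become the three kinds of terms of
    the relation. *)
Lemma trisum_mid i j k l d (p : chain Q i k) (x : Q k l d) (q : chain Q l j)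
    (H : forall m n, chain Q i m -> chain Q m n -> chain Q n j -> M) :
  trisum (ccat p (Ccons x q)) H =
  trisum p (fun m n a b b' => H m n a b (ccat b' (Ccons x q))) +
  \sum_(s <- splits p) \sum_(t <- splits q)
    H _ _ (cl s) (ccat (cr s) (Ccons x (cl t))) (cr t) +
  trisum q (fun m n a b b' => H m n (ccat p (Ccons x a)) b b').
Proof.
rewrite /trisum (sum_splits_mid _ _ _ (fun m a b =>
  \sum_(t <- splits b) H _ _ a (cl t) (cr t))); congr (_ + _).
rewrite -big_split /=; apply: eq_bigr => s _.
exact: (sum_splits_mid _ _ _ (fun n b b' => H _ n (cl s) b b')).
Qed.

End Splits.

Lemma trisum_cmap (I J : Type) (Q : I -> I -> int -> Type) (M : nmodType)
    (u : J -> I) i j (c : chain (fun a b d => Q (u a) (u b) d) i j)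
    (H : forall m n, chain Q (u i) m -> chain Q m n -> chain Q n (u j) -> M) :
  trisum (cmap c) H =
  trisum c (fun m n a b b' => H _ _ (cmap a) (cmap b) (cmap b')).
Proof.
rewrite /trisum (sum_splits_cmap c (fun m a b =>
  \sum_(t <- splits b) H _ _ a (cl t) (cr t))).
apply: eq_bigr => s _; exact: (sum_splits_cmap _ (fun n b b' => H _ n _ b b')).
Qed.

(** * Shifted degrees, signs and valuations *)

Lemma sdeg_ge0 (I : Type) (Q : I -> I -> int -> Type) i j (c : chain Q i j) :
  cpos c -> 0 <= sdeg c.
Proof. by elim: c => //= i' j' k d x c IH /andP[d0 /IH]; lia. Qed.

(** The difference $|m|+|n|-|m+n|$ is $0$ when the signs agree and $2\min(|m|,|n|)$ otherwise.
    Additivity of [nsign] rests on this, its exponent being an absolute value. *)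
Lemma odd_abszD (m n : int) : odd (absz (m + n)) = odd (absz m + absz n)%N.
Proof.
suff [k ->] : exists k, (absz m + absz n = absz (m + n)%R + k.*2)%N.
  by rewrite oddD odd_double addbF.
have [m0|m0] := leP 0 m; have [n0|n0] := leP 0 n.
- by exists 0%N; lia.
- by exists (minn (absz m) (absz n)); lia.
- by exists (minn (absz m) (absz n)); lia.
- by exists 0%N; lia.
Qed.

(** The operations have degree one in the shifted grading: [b] is replaced by an entry of shifted
    degree [sdeg b + 1]. *)
Lemma sdeg_insert (I : Type) (Q : I -> I -> int -> Type) i j k l
    (a : chain Q i j) (b : chain Q j k) (c : chain Q k l)
    (x : Q j k (sdeg b + 2)) :
  sdeg (ccat a (Ccons x c)) = sdeg (ccat a (ccat b c)) + 1.
Proof. by rewrite !sdeg_ccat /=; move: (sdeg b) => n; lia. Qed.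

Section Nsign.
Variable R : realType.

Lemma nsignD m n : nsign R (m + n) = nsign R m * nsign R n.
Proof. by rewrite /nsign -exprD -signr_odd odd_abszD signr_odd. Qed.

Lemma nsignMK n : cancel ( *%R (nsign R n)) ( *%R (nsign R n)).
Proof. by move=> a; rewrite /nsign signrMK. Qed.

Lemma nsignS n : nsign R (n + 1) = - nsign R n.
Proof. by rewrite nsignD mulrN1. Qed.

End Nsign.

Lemma bar_sumE (R : realType) (I : Type) (A : ainf_data R I) i j
    (M : lmodType (novikov R)) (F : hchain A i j -> M) c :
  bar_sum F c = trisum c (fun m n a b b' => if (0 < clen b)%N then
    nsign R (sdeg a) *: F (ccat a (Ccons (mop b (sdeg b + 2)) b')) else 0).
Proof. by apply: eq_bigr => s _; rewrite big_mkcond. Qed.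

Lemma clen_cmap (I J : Type) (Q : I -> I -> int -> Type) (u : J -> I) i j
    (c : chain (fun a b d => Q (u a) (u b) d) i j) : clen (cmap c) = clen c.
Proof. by elim: c => //= i' j' k d x c ->. Qed.

(** Removes two finite valuations, in the application those of the inserted $P$ and of the $P$
    divided by, at the price of changing the constant. *)
Lemma le_shift (R : realType) (s t a b : R) (x y n : \bar R) :
  s + a <= t + b ->
  (t%:E + (x + (b%:E + y)) <= n + a%:E)%E -> (s%:E + (x + y) <= n)%E.
Proof.
move=> h; rewrite -leeBlDr // => h'; apply: le_trans h'; rewrite leeBrDr //.
rewrite addeAC (addeCA x) [leRHS]addeA; exact: leeD.
Qed.

(** * The coefficient of $P$ and the values of the Koszul map on words *)

Section Koszul.
Variables (R : realType) (C : ainf_cat R) (r : nat) (G L : 'I_r -> Ob C).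
Variable P : forall i j, mor C (G i) (L j) 0.
Hypothesis HP : module_generator P.
Local Notation Lambda := (novikov R).
Local Notation W := (subcat C G).
Local Notation V := (subcat C L).
Local Notation cm := (cmap (Q := fun a b d => mor C a b d)).
Local Notation kfun := (koszul_fun P).
Local Notation koszul := (koszul HP).

Lemma gen_coef_linear i a (x y : mor C (G i) (L i) 0) :
  gen_coef P (a *: x + y) = a * gen_coef P x + gen_coef P y.
Proof.
apply: gen_coef_unique => //.
by rewrite scalerDl -scalerA -!(gen_coefE HP).
Qed.

Lemma gen_coefD i (x y : mor C (G i) (L i) 0) :
  gen_coef P (x + y) = gen_coef P x + gen_coef P y.
Proof. by rewrite -[x]scale1r gen_coef_linear mul1r scale1r. Qed.

Lemma gen_coef0 i : gen_coef P (0 : mor C (G i) (L i) 0) = 0.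
Proof. by apply: gen_coef_unique => //; rewrite scale0r. Qed.

Lemma gen_coefZ i a (x : mor C (G i) (L i) 0) :
  gen_coef P (a *: x) = a * gen_coef P x.
Proof. by rewrite -[a *: x]addr0 gen_coef_linear gen_coef0 addr0. Qed.

Lemma gen_coefN i (x : mor C (G i) (L i) 0) :
  gen_coef P (- x) = - gen_coef P x.
Proof. by rewrite -scaleN1r gen_coefZ mulN1r. Qed.

Lemma gen_coef_sum i (T : Type) (s : seq T) (p : pred T)
    (F : T -> mor C (G i) (L i) 0) :
  gen_coef P (\sum_(t <- s | p t) F t) = \sum_(t <- s | p t) gen_coef P (F t).
Proof. by apply: big_morph; [exact: gen_coefD|exact: gen_coef0]. Qed.

(* convertible to [koszul_chain P z (Word w)], whose type hides the endpoints of
   the word *)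
Definition kchain i j k (z : hchain W i j) (w : hchain V j k) :
    hchain C (G i) (L k) :=
  ccat (cm z) (Ccons (P j j) (cm w)).

Lemma sdeg_kchain i j k (z : hchain W i j) (w : hchain V j k) :
  sdeg (kchain z w) = sdeg z - 1 + sdeg w.
Proof.
by rewrite /kchain sdeg_ccat /= !(sdeg_cmap (A := C)) sub0r addrA.
Qed.

Lemma koszul_funE i j (z : hchain W i j) (w : hchain V j i) :
  kfun z (Word w) = nsign R (sdeg w) * gen_coef P (mop (kchain z w) 0).
Proof. by []. Qed.

(** The operation on $Z, P, X$ has output degree [sdeg z + sdeg w + 1], and only output degree 0
    contributes. *)
Lemma koszul_fun_degree i j (z : hchain W i j) (w : hchain V j i) :
  sdeg w != - (sdeg z + 1) -> kfun z (Word w) = 0.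
Proof.
move=> h; rewrite /koszul_fun (ainf_degree (cat_axioms C)).
  by rewrite gen_coef0 mulr0.
by rewrite (sdeg_kchain z w) /=; move: (sdeg z) (sdeg w) h => m n; lia.
Qed.

Lemma dual_res_supp i j p (f : hword V -> Lambda^o) (w : hchain V j i) :
  cpos w -> sdeg w = - p -> dual_res i j p f (Word w) = f (Word w).
Proof.
by move=> cw wp; rewrite /dual_res /dual_supp /= !eqxx cw wp eqxx.
Qed.

Lemma koszul_apply i j (z : hchain W i j) p (w : hchain V j i) :
  cpos w -> sdeg w = - p -> koszul z p (Word w) = kfun z (Word w).
Proof. exact: dual_res_supp. Qed.

(** In degree [sdeg z + 1] the restriction to one degree loses nothing, since [koszul_fun] already
    vanishes on words of other degrees. *)
Lemma koszul_apply_sdeg i j (z : hchain W i j) (w : hchain V j i) :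
  cpos w -> koszul z (sdeg z + 1) (Word w) = kfun z (Word w).
Proof.
move=> cw; have [e|ne] := eqVneq (sdeg w) (- (sdeg z + 1)).
  exact: koszul_apply.
rewrite koszul_fun_degree //= /dual_res /dual_supp /= (negbTE ne).
by rewrite !andbF.
Qed.

Lemma koszul_apply_eq0 i j (z : hchain W i j) p k l (w : hchain V k l) :
  (k != j) || (l != i) -> koszul z p (Word w) = 0.
Proof.
move=> h; rewrite /= /dual_res /dual_supp /=.
by case/orP: h => /negbTE ->; rewrite ?andbF.
Qed.

(** On the empty chain the functional would have degree 1 and pair with words of shifted degree
    $-1$, but words in $\bar V$ have shifted degree at least 0. *)
Lemma koszul_nil i j (z : hchain W i j) :
  clen z = 0%N -> koszul z (sdeg z + 1) = 0.
Proof.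
move=> z0; have -> : sdeg z = 0 by case: z z0.
apply/val_inj/funext => v /=; rewrite /dual_res.
by case: ifP => // /and4P[_ _ cv /eqP v1]; have := sdeg_ge0 cv; rewrite v1.
Qed.

(** * The $A_\infty$ relation on $Z, P, X$ *)

(** The relation of [C] on [kchain z w], split at $P$. The last sign involves [sdeg z - 1] because
    the prefix there contains $P$, of shifted degree $-1$. The middle sum has no length condition
    because its inner operation always has $P$ among its inputs. *)
Lemma kchain_ainf i j (z : hchain W i j) (w : hchain V j i) :
  bar_sum (fun z' : hchain W i j => mop (kchain z' w) 0) z +
  \sum_(s <- splits z) \sum_(t <- splits w)
    nsign R (sdeg (cl s)) *: mop (ccat (cm (cl s)) (Ccons
      (mop (kchain (cr s) (cl t)) (sdeg (kchain (cr s) (cl t)) + 2))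
      (cm (cr t)))) 0 +
  nsign R (sdeg z - 1) *:
    bar_sum (fun w' : hchain V j i => mop (kchain z w') 0) w
  = 0.
Proof.
rewrite -[RHS](ainf_relation (cat_axioms C) (kchain z w) 0).
rewrite [RHS]bar_sumE /kchain trisum_mid; congr (_ + _ + _).
- rewrite bar_sumE trisum_cmap; apply: eq_trisum => m n a b b' _.
  rewrite clen_cmap !(sdeg_cmap (A := C)); case: ifP => // _.
  by rewrite cmap_ccat /= ccatA.
- rewrite (sum_splits_cmap z (fun m a b => \sum_(t <- splits (cm w))
    if (0 < clen (ccat b (Ccons (P j j) (cl t))))%N then nsign R (sdeg a) *:
      mop (ccat a (Ccons (mop (ccat b (Ccons (P j j) (cl t)))
        (sdeg (ccat b (Ccons (P j j) (cl t))) + 2)) (cr t))) 0 else 0)).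
  apply: eq_bigr => s _.
  rewrite (sum_splits_cmap w (fun m a b =>
    if (0 < clen (ccat (cm (cr s)) (Ccons (P j j) a)))%N then
      nsign R (sdeg (cm (cl s))) *:
      mop (ccat (cm (cl s)) (Ccons (mop (ccat (cm (cr s)) (Ccons (P j j) a))
        (sdeg (ccat (cm (cr s)) (Ccons (P j j) a)) + 2)) b)) 0 else 0)).
  apply: eq_bigr => t _.
  by rewrite clen_ccat /= addnS (sdeg_cmap (A := C)).
- rewrite bar_sumE [RHS]trisum_cmap /trisum scaler_sumr.
  apply: eq_bigr => s _; rewrite scaler_sumr; apply: eq_bigr => t _.
  rewrite clen_cmap; case: ifP => _; last by rewrite scaler0.
  rewrite scalerA -nsignD cmap_ccat /= !sdeg_ccat /= !(sdeg_cmap (A := C)).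
  by rewrite sub0r -[_ - 1 + _]addrA ccatA.
Qed.

(** The inner result is a multiple of $P$, so multilinearity extracts its coefficient and leaves a
    product of two; the sign undoes the factors $(-1)^{|X|}$ in the two values of $\kappa$. *)
Lemma gen_coef_middle i j m m' (z1 : hchain W i m) (z2 : hchain W m j)
    (w1 : hchain V j m') (w2 : hchain V m' i) :
  cpos w1 -> cpos w2 ->
  gen_coef P (mop (ccat (cm z1) (Ccons (mop (kchain z2 w1)
    (sdeg (kchain z2 w1) + 2)) (cm w2))) 0) =
  nsign R (sdeg w1 + sdeg w2) *
    ((koszul z2 (sdeg z2 + 1) (Word w1) : Lambda) *
     (koszul z1 (sdeg z1 + 1) (Word w2) : Lambda)).
Proof.
move=> p1 p2; have HC := ainf_multilinear (cat_axioms C).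
have [e|ne] := eqVneq m' m; last first.
  (* The inner result lies in $hom(G_m, L_{m'})$, which vanishes off the diagonal; $\kappa$ vanishes
     on the mismatched words as well. *)
  rewrite [mop (kchain z2 w1) _](gen_zero HP); last by rewrite eq_sym ne.
  rewrite (multilinear0 _ _ _ (HC _ _ _)) gen_coef0.
  by rewrite koszul_apply_eq0 ?ne ?orbT // mul0r mulr0.
subst m'; rewrite !koszul_apply_sdeg // /koszul_fun /=.
rewrite -[koszul_chain P z2 _]/(kchain z2 w1).
rewrite -[koszul_chain P z1 _]/(kchain z1 w2).
rewrite mulrACA -nsignD nsignMK.
have := ainf_degree (cat_axioms C) (c := kchain z2 w1) (e := 0).
(* The inner result has degree [d]: it is a multiple of $P$ if [d] is 0, and otherwise both sides
   vanish. *)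
move: (sdeg (kchain z2 w1) + 2) => d.
have [->|d0] := eqVneq d 0 => [_|h].
  rewrite {1}(gen_coefE HP (mop (kchain z2 w1) 0)).
  rewrite (multilinearZ _ _ _ _ (HC _ _ _)) gen_coefZ.
  by rewrite -[ccat _ _]/(kchain z1 w2).
rewrite h // gen_coef0 mul0r [mop (kchain z2 w1) _](gen_zero HP); last first.
  by rewrite d0 orbT.
by rewrite (multilinear0 _ _ _ (HC _ _ _)) gen_coef0.
Qed.

Lemma gen_coef_bar_sum (I : Type) (A : ainf_data R I) k l i
    (F : hchain A k l -> mor C (G i) (L i) 0) c :
  gen_coef P (bar_sum F c) =
  bar_sum (fun c' => gen_coef P (F c') : Lambda^o) c.
Proof.
rewrite /bar_sum gen_coef_sum; apply: eq_bigr => s _.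
by rewrite gen_coef_sum; apply: eq_bigr => t _; rewrite gen_coefZ.
Qed.

(** * Multilinearity, degree and boundedness of $\kappa$ *)

Lemma koszul_multilinear i j p :
  multilinear (fun z : hchain W i j => koszul z p).
Proof.
move=> k l d a b e x y; apply/val_inj/funext => w /=.
rewrite /dual_res !fctE; case: ifP; last by rewrite scaler0 addr0.
case: w => m n w /= /and4P[/= /eqP em /eqP en _ _]; subst m n.
rewrite /koszul_fun /=.
rewrite -[e *: (_ : Lambda^o)]/(e * _ : Lambda) mulrCA -mulrDr.
congr (_ * _); rewrite -gen_coef_linear; congr (gen_coef P _).
rewrite /koszul_chain /= !cmap_ccat /= !ccatA /=.
by rewrite (ainf_multilinear (cat_axioms C)).
Qed.

Lemma koszul_degree i j (z : hchain W i j) p :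
  p != sdeg z + 1 -> koszul z p = 0.
Proof.
move=> h; apply/val_inj/funext => -[m n w] /=; rewrite /dual_res.
case: ifP => // /and4P[/= /eqP em /eqP en _ /eqP wp]; subst m n.
by apply: koszul_fun_degree; rewrite wp eqr_opp.
Qed.

(** Entries of positive degree have nonnegative shifted degree, so the new entry has degree
    [sdeg b + 2] at least 2: the bar differential stays within words in $\bar V$. *)
Lemma cpos_mop i j k l (a : hchain V i j) (b : hchain V j k)
    (c : hchain V k l) (x : mor V j k (sdeg b + 2)) :
  cpos (ccat a (ccat b c)) -> cpos (ccat a (Ccons x c)).
Proof.
rewrite !cpos_ccat /= => /and3P[-> b0 ->]; rewrite andbT.
by have := sdeg_ge0 b0; move: (sdeg b) => n; lia.
Qed.

(** A free generator is nonzero, since $1 \ne 0$ in $\Lambda$. *)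
Lemma hval_gen i : exists t : R, hval (P i i) = t%:E.
Proof.
have HV := ainf_valued (cat_axioms C).
move: (hval_gtNy HV (P i i)) (hval_eqy HV (P i i)).
case: (hval (P i i)) => // [t _ _|_ [/(_ erefl) P0 _]]; first by exists t.
have [_ /(_ 1)] := gen_free HP i; rewrite P0 scaler0 => /(_ erefl) /eqP.
by rewrite oner_eq0.
Qed.

Lemma koszul_fun_bound : exists s : R, forall i j (z : hchain W i j)
  (w : hchain V j i),
  (s%:E + (cval z + cval w) <= nval (kfun z (Word w)))%E.
Proof.
have HC := cat_axioms C; have HV := ainf_valued HC.
(* The operations mix both families of objects, and their bound is uniform over a finite family, so
   all objects are placed in one. *)
pose u (s : 'I_r + 'I_r) := match s with inl a => G a | inr a => L a end.
have [rho hrho] := ainf_bounded HC u.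
pose v i : R := fine (hval (P i i)).
have hv i : hval (P i i) = (v i)%:E by rewrite /v; have [t ->] := hval_gen i.
(* Dominates the valuations of all [P i i] at once, making the constant independent of the
   endpoints. *)
pose B : R := \sum_i `|v i|.
have leB (i : 'I_r) : `|v i| <= B by rewrite /B (bigD1 i) //= lerDl sumr_ge0.
(* One [B] pays for the inserted [P j j], the other for the division by [P i i]. *)
exists (rho - B - B) => i j z w; apply: nval_nsign.
rewrite -[koszul_chain P z _]/(kchain z w).
have : (rho%:E + (cval z + ((v j)%:E + cval w)) <=
    nval (gen_coef P (mop (kchain z w) 0)) + (v i)%:E)%E.
  rewrite -!hv -(hvalZ HV) -(gen_coefE HP).
  pose zu : hchain (subcat C u) (inl i) (inl j) :=
    cmap (Q := fun a b d => mor (subcat C u) a b d) (u := inl) z.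
  pose wu : hchain (subcat C u) (inr j) (inr i) :=
    cmap (Q := fun a b d => mor (subcat C u) a b d) (u := inr) w.
  pose Pu : mor (subcat C u) (inl j) (inr j) 0 := P j j.
  have := hrho _ _ (ccat zu (Ccons Pu wu)) 0.
  rewrite clen_ccat /= addnS => /(_ isT).
  rewrite -!(cval_cmap (A := C)) cmap_ccat /=.
  rewrite (cmap_comp (Q := fun a b d => mor C a b d) (u := u) (v := inl)).
  rewrite (cmap_comp (Q := fun a b d => mor C a b d) (u := u) (v := inr)).
  by rewrite cval_ccat.
apply: le_shift.
have := leB i; have := leB j; rewrite !ler_norml; lra.
Qed.

Lemma koszul_bounded : exists s : R, forall i j (z : hchain W i j) p,
  (s%:E + cval z <= hval (koszul z p))%E.
Proof.
have [s hs] := koszul_fun_bound; exists s => i j z p /=.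
apply/ereal_infP => _ [[k l w] /= w0 <-]; rewrite /dual_res.
case: ifP => [/and4P[/= /eqP ek /eqP el _ _]|_]; last by rewrite nval0 leey.
by subst k l; have := hs _ _ z w; rewrite w0 adde0.
Qed.

(** * The $M_2$ and $M_1$ terms evaluated on a word *)

(** $M_2$ carries the sign of the degree [sdeg z1 + 1] of its first factor, the relation that of
    [sdeg z1]; hence the minus sign. The dual product feeds the first part of the word to its second
    factor, here the inner operation. *)
Lemma dual_m2_koszul i m j (z1 : hchain W i m) (z2 : hchain W m j) e
    (w : hchain V j i) :
  cpos w -> sdeg w = - e ->
  (mop (chain2 (koszul z1 (sdeg z1 + 1)) (koszul z2 (sdeg z2 + 1)) :
     hchain (bar_dual (subcat_filtered C L)) i j) e : bdual V i j e) (Word w) =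
  - nsign R (sdeg w) * gen_coef P (\sum_(t <- splits w)
    nsign R (sdeg z1) *: mop (ccat (cm z1) (Ccons
      (mop (kchain z2 (cl t)) (sdeg (kchain z2 (cl t)) + 2))
      (cm (cr t)))) 0).
Proof.
move=> cw we.
rewrite -[LHS]/(dual_res i j e (dual_mul (koszul z1 (sdeg z1 + 1))
  (koszul z2 (sdeg z2 + 1))) (Word w)).
rewrite dual_res_supp /dual_mul // gen_coef_sum scaler_sumr mulr_sumr.
apply: (eq_big_splits (H := fun n a b => nsign R (sdeg z1 + 1) *:
  ((koszul z2 (sdeg z2 + 1) (Word a) : Lambda) *
   (koszul z1 (sdeg z1 + 1) (Word b) : Lambda) : Lambda^o))
  (H' := fun n a b => (- nsign R (sdeg w) * gen_coef P (nsign R (sdeg z1) *: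
    mop (ccat (cm z1) (Ccons (mop (kchain z2 a) (sdeg (kchain z2 a) + 2))
      (cm b))) 0) : Lambda^o))) => n a b /= abw.
have := cw; rewrite -abw cpos_ccat => /andP[ca cb].
rewrite gen_coefZ gen_coef_middle // sdeg_ccat mulNr mulrCA nsignMK.
by rewrite nsignS -mulNr.
Qed.

Lemma dual_m2_eq0 i j k p q (f : bdual V i j p) (g : bdual V j k q) e :
  f = 0 \/ g = 0 -> dual_m2 (subcat_filtered C L) f g e = 0.
Proof.
move=> fg; apply/val_inj/funext => v /=; rewrite /dual_res.
case: ifP => // _; rewrite /dual_mul big1 ?scaler0 // => s _.
by case: fg => ->; rewrite ?mul0r ?mulr0.
Qed.

(** The signs of [sdeg z + 1] in $M_1$ and of [sdeg z - 1] in the relation agree. The minus sign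
    appears because the bar differential shifts the degree of the word by one, and so flips the
    factor $(-1)^{|X|}$ in $\kappa$. *)
Lemma dual_m1_koszul i j (z : hchain W i j) e (w : hchain V j i) :
  cpos w -> sdeg w = - e ->
  (mop (chain1 (koszul z (sdeg z + 1)) :
     hchain (bar_dual (subcat_filtered C L)) i j) e : bdual V i j e) (Word w) =
  - nsign R (sdeg w) * gen_coef P (nsign R (sdeg z - 1) *:
    bar_sum (fun w' : hchain V j i => mop (kchain z w') 0) w).
Proof.
move=> cw we.
rewrite -[LHS]/(dual_res i j e (dual_d (koszul z (sdeg z + 1))) (Word w)).
rewrite dual_res_supp /dual_d // gen_coefZ gen_coef_bar_sum.
rewrite (_ : nsign R (sdeg z - 1) = nsign R (sdeg z + 1)); last first.
  by rewrite -[in RHS](subrK 1 (sdeg z)) !nsignS opprK.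
rewrite -[LHS]/(nsign R (sdeg z + 1) * _ : Lambda) mulrCA; congr (_ * _).
rewrite !bar_sumE.
transitivity (trisum w (fun m n a b b' => - nsign R (sdeg w) *:
  (if (0 < clen b)%N then nsign R (sdeg a) *:
    (gen_coef P (mop (kchain z (ccat a (Ccons (mop b (sdeg b + 2)) b'))) 0)
      : Lambda^o) else 0))); last first.
  rewrite -[RHS]/(_ *: _ : Lambda^o) /trisum scaler_sumr.
  by apply: eq_bigr => s _; rewrite scaler_sumr.
apply: eq_trisum => m n a b b' /= abw; case: ifP => _; last by rewrite scaler0.
have := cw; rewrite -abw => /cpos_mop cw'.
have /= -> := koszul_apply_sdeg z (cw' (mop b (sdeg b + 2))).
rewrite -[RHS]/(_ * (nsign R (sdeg a) * _) : Lambda) [RHS]mulrCA.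
by rewrite koszul_funE sdeg_insert nsignS.
Qed.

(** * The homomorphism relation, checked word by word *)

Lemma bdual_eval_supp i j p (f : bdual V i j p) v :
  ~~ dual_supp i j p v -> f v = 0.
Proof. by have [_ + _] := bdualP f; apply. Qed.

Lemma bdual_evalD i j p (f g : bdual V i j p) v : (f + g) v = f v + g v.
Proof. by []. Qed.

Lemma bdual_eval_sum i j p (T : Type) (s : seq T) (q : pred T)
    (F : T -> bdual V i j p) v :
  (\sum_(t <- s | q t) F t) v = \sum_(t <- s | q t) F t v.
Proof. exact: (big_morph (fun f : bdual V i j p => f v)). Qed.

Lemma bdual_eval_bar_sum (A : ainf_data R 'I_r) k l i j p
    (F : hchain A k l -> bdual V i j p) c v :
  bar_sum F c v = bar_sum (fun c' => F c' v) c.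
Proof.
rewrite /bar_sum bdual_eval_sum; apply: eq_bigr => s _.
by rewrite bdual_eval_sum; apply: eq_bigr.
Qed.

Lemma koszul_relation i j (z : hchain W i j) e :
  mop (chain1 (koszul z (sdeg z + 1)) :
    hchain (bar_dual (subcat_filtered C L)) i j) e +
  \sum_(s <- splits z | (0 < clen (cl s))%N && (0 < clen (cr s))%N)
    mop (chain2 (koszul (cl s) (sdeg (cl s) + 1))
                (koszul (cr s) (sdeg (cr s) + 1)) :
      hchain (bar_dual (subcat_filtered C L)) i j) e =
  bar_sum (fun z' => koszul z' e) z.
Proof.
pose m1 : bdual V i j e := mop (chain1 (koszul z (sdeg z + 1)) :
  hchain (bar_dual (subcat_filtered C L)) i j) e.
pose m2 m (a : hchain W i m) (b : hchain W m j) : bdual V i j e :=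
  mop (chain2 (koszul a (sdeg a + 1)) (koszul b (sdeg b + 1)) :
    hchain (bar_dual (subcat_filtered C L)) i j) e.
pose rhs : bdual V i j e := bar_sum (fun z' => koszul z' e) z.
(* Trivial cuts may be added: one factor is then $\kappa$ of an empty chain, which is zero. *)
rewrite (_ : \sum_(s <- _ | _) _ = \sum_(s <- splits z) m2 _ (cl s) (cr s)).
  suff : m1 + \sum_(s <- splits z) m2 _ (cl s) (cr s) = rhs by [].
  apply/val_inj/funext => v; rewrite -[LHS]/(bdual_fun (m1 + _) v).
  rewrite -[RHS]/(bdual_fun rhs v).
  have [hv|hv] := boolP (dual_supp i j e v); last by rewrite !bdual_eval_supp.
  case: v hv => [k l w] /and4P[/eqP ek /eqP el cw /eqP we].
  rewrite /= in ek el cw we; subst k l.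
  rewrite bdual_eval_bar_sum bdual_evalD bdual_eval_sum.
  rewrite [m1 _](dual_m1_koszul z cw we).
  under eq_bigr do rewrite [m2 _ _ _ _](dual_m2_koszul _ _ cw we).
  (* The $M_1$ and $M_2$ parts share the factor $-(-1)^{|X|}$, whose minus sign is moved inside the
     coefficient of $P$. *)
  rewrite -mulr_sumr -gen_coef_sum -mulrDr -gen_coefD mulNr -mulrN -gen_coefN.
  (* By the relation on $Z, P, X$, the negated sum of these two kinds of terms is the kind whose
     inner operation sees only $Z$. *)
  rewrite (_ : - _ = bar_sum (fun z' : hchain W i j => mop (kchain z' w) 0) z).
    rewrite gen_coef_bar_sum -[LHS]/(_ *: _ : Lambda^o) !bar_sumE /trisum.
    rewrite scaler_sumr; apply: eq_bigr => s _; rewrite scaler_sumr.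
    apply: eq_bigr => t _; case: ifP => _; last by rewrite scaler0.
    by rewrite koszul_apply // scalerA mulrC -scalerA; congr (_ *: _).
  by apply/eqP; rewrite eq_sym -addr_eq0 addrCA [_ + _]addrC kchain_ainf.
rewrite big_mkcond; apply: eq_bigr => s _.
case: ifP => // /negbT; rewrite negb_and -!eqn0Ngt => h; apply/esym.
apply: dual_m2_eq0; case/orP: h => /eqP h; [left|right]; exact: koszul_nil.
Qed.

End Koszul.

Theorem proposition4p8 (R : realType) (C : ainf_cat R) (r : nat)
    (G L : 'I_r -> Ob C)
    (P : forall i j, mor C (G i) (L j) 0)
    (HP : module_generator P)
    (HGG : forall i j d (x : mor C (G i) (G j) d), 0 < d -> x = 0)
    (HLL : forall i j d (x : mor C (L i) (L j) d), d < 0 -> x = 0)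
    (HLfg : finitely_generated (subcat C L))
    (HL0 : forall i, exists x : mor C (L i) (L i) 0, free_generator x)
    (HL0' : forall i j (x : mor C (L i) (L j) 0), i != j -> x = 0) :
  @ainf_hom R 'I_r (subcat C G) (bar_dual (subcat_filtered C L)) (koszul HP).
Proof.
split.
- exact: koszul_multilinear.
- exact: koszul_degree.
- by have [s hs] := koszul_bounded HP; exists s.
- by move=> *; exact: koszul_relation.
Qed.
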